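(* Let $q$ be a rational number with $0<q<1$ such that $q \neq 1/n$ for every integer $n \geq 2$, and such that the denominator of $q$ (written in lowest terms) is odd. Then the monoid algebra $\mathbb{Q}[M_q]$ is atomic.
   Context: For a positive rational $q$, the exponentially cyclic Puiseux monoid is the additive submonoid $M_q := \langle q^n : n \in \mathbb{N}_0 \rangle$ of $(\mathbb{Q}_{\geq 0},+)$ generated by the powers $q^0, q^1, q^2, \ldots$. For a commutative ring $R$, the monoid algebra $R[M_q]$ is the ring of all finite expressions $\sum_i r_i x^{m_i}$ with $r_i \in R$ and exponents $m_i \in M_q$, multiplied via $x^{a}x^{b}=x^{a+b}$; it is an integral domain when $R$ is. An integral domain is atomic if every nonzero nonunit element is a finite product of irreducible elements (atoms). *)

(* Defs.v *)
From HB Require Import structures.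
From mathcomp Require Import all_boot all_order all_algebra.
From mathcomp.multinomials Require Import monalg.
From Stdlib Require Import ClassicalEpsilon.

Set Implicit Arguments.
Unset Strict Implicit.
Unset Printing Implicit Defensive.

Import Order.TTheory GRing.Theory Num.Theory.
Local Open Scope ring_scope.

(* The exponentially cyclic Puiseux monoid M_q = < q^n : n in N_0 >,
   i.e. all finite sums of powers q^n (with repetitions).  The generators are
   taken as |q|^n so that the type is a (reduced) monoid for every rational q;
   for q > 0 (the only case used) this is exactly < q^n : n in N_0 >. *)
Definition inMq (q x : rat) : Prop :=
  exists s : seq nat, x = \sum_(n <- s) `|q| ^+ n.

Definition memMq (q x : rat) : bool :=
  if excluded_middle_informative (inMq q x) then true else false.

Lemma memMqP q x : reflect (inMq q x) (memMq q x).
Proof. by rewrite /memMq; case: excluded_middle_informative => h; constructor. Qed.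

Definition Mq (q : rat) : Type := {x : rat | memMq q x}.

HB.instance Definition _ q := Choice.on (Mq q).

Lemma Mq0_subproof q : memMq q 0.
Proof. by apply/memMqP; exists [::]; rewrite big_nil. Qed.

Lemma MqD_subproof q x y : memMq q x -> memMq q y -> memMq q (x + y).
Proof.
move=> /memMqP[s ->] /memMqP[t ->]; apply/memMqP; exists (s ++ t).
by rewrite big_cat.
Qed.

Lemma Mq_ge0 q (x : Mq q) : 0 <= val x.
Proof.
case: x => x /= /memMqP[s ->]; apply: sumr_ge0 => n _.
by apply: exprn_ge0; apply: normr_ge0.
Qed.

Definition Mq_zero q : Mq q := exist _ 0 (Mq0_subproof q).
Definition Mq_add q (x y : Mq q) : Mq q :=
  exist _ (val x + val y) (MqD_subproof (valP x) (valP y)).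

Lemma Mq_addA q : associative (@Mq_add q).
Proof. by move=> x y z; apply: val_inj; rewrite /= addrA. Qed.
Lemma Mq_add0 q : left_id (Mq_zero q) (@Mq_add q).
Proof. by move=> x; apply: val_inj; rewrite /= add0r. Qed.
Lemma Mq_addx0 q : right_id (Mq_zero q) (@Mq_add q).
Proof. by move=> x; apply: val_inj; rewrite /= addr0. Qed.
Lemma Mq_unit q (x y : Mq q) : Mq_add x y = Mq_zero q -> x = Mq_zero q /\ y = Mq_zero q.
Proof.
move=> /(congr1 val) /= /eqP; rewrite paddr_eq0 ?Mq_ge0 // => /andP[/eqP hx /eqP hy].
by split; apply: val_inj.
Qed.
Lemma Mq_addC q : commutative (@Mq_add q).
Proof. by move=> x y; apply: val_inj; rewrite /= addrC. Qed.

(* The monoid operation of M_q (written multiplicatively in monalg) is the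
   addition of rationals, with neutral element 0. *)
HB.instance Definition _ q := Choice_isMonomialDef.Build (Mq q)
  (@Mq_addA q) (@Mq_add0 q) (@Mq_addx0 q) (@Mq_unit q).
HB.instance Definition _ q := MonomialDef_isConomialDef.Build (Mq q) (@Mq_addC q).

Notation monoid_algebra R q := {malg R[Mq q]}.

Definition is_unit (A : comNzRingType) (x : A) : Prop := exists y : A, x * y = 1.

Definition atom (A : comNzRingType) (x : A) : Prop :=
  [/\ x != 0, ~ is_unit x &
      forall a b : A, x = a * b -> is_unit a \/ is_unit b].

Definition atomic (A : comNzRingType) : Prop :=
  forall x : A, x != 0 -> ~ is_unit x ->
    exists s : seq A, (forall a, a \in s -> atom a) /\ x = \prod_(a <- s) a.

(* Main.v *)
(** Write q = a/b in lowest terms; since q is not 1/n, a >= 2.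

    Let h be a nonunit divisor of g with h(0) <> 0.  If all exponents of h are
    smaller than q^i, they lie in q^(i+1) M_q, so that, for L large, h is a
    polynomial in y^A, where y = x^(1/b^L) and A = a^(i+1).  The roots of h in
    y are then stable under multiplication by the A-th roots of unity.  As A is
    coprime to b, raising them to suitable powers of b yields A distinct roots
    of a polynomial that depends only on g; hence a^(i+1) is bounded and the
    degree of h is bounded below in terms of g.

    If moreover g has an exponent m all of whose nonzero divisors in M_q are at
    least d > 0, then also the divisors h of g with h(0) = 0 have degree at
    least d, so the number of nonunit factors of g is bounded and g is a
    product of atoms.

    Finally let f have all its exponents in b^(-K) Z.  If m - q^K is outside
    M_q for some exponent m of f, then m has the property above, because
    b q^(k+1) = a q^k allows one to replace a summand q^k, k > K, of m by q^K.
    Otherwise x^(q^K) divides f, and one concludes by induction, as x^(q^K)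
    has the property too. *)
Require Import Defs.
From HB Require Import structures.
From Stdlib Require Import Classical.
From mathcomp Require Import all_boot all_order all_algebra all_field ring finmap.
From mathcomp.multinomials Require Import monalg.

Set Implicit Arguments.
Unset Strict Implicit.
Unset Printing Implicit Defensive.
Import Order.TTheory GRing.Theory Num.Theory.
Local Open Scope ring_scope.

(** * Arithmetic of M_q: denominators, carries and atoms *)

Local Notation a_ q := (`|numq q|%N).
Local Notation b_ q := (`|denq q|%N).

Definition powsum (q : rat) (s : seq nat) : rat := \sum_(n <- s) q ^+ n.

Definition lev (q : rat) (L : nat) (x : rat) : bool :=
  (b_ q)%:R ^+ L * x \is a Num.nat.

(* The exponent in y = x^(1/b^L) of the monomial of x-exponent [x]; a junk value
   unless [lev q L x]. *)
Definition expo (q : rat) (L : nat) (x : rat) : nat :=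
  Num.truncn ((b_ q)%:R ^+ L * x).

Section Monoid.
Context (q : rat) (q_gt0 : 0 < q).

Lemma inMqE x : inMq q x <-> exists s, x = powsum q s.
Proof. by rewrite /inMq /powsum gtr0_norm. Qed.

Lemma inMqD x y : inMq q x -> inMq q y -> inMq q (x + y).
Proof.
by move=> [s ->] [t ->]; exists (s ++ t); rewrite big_cat.
Qed.

Lemma inMq_powsum s : inMq q (powsum q s).
Proof. by apply/inMqE; exists s. Qed.

Lemma powsum_ge0 s : 0 <= powsum q s.
Proof. by apply: sumr_ge0 => i _; rewrite exprn_ge0 // ltW. Qed.

Lemma powsum_rem k s : k \in s -> powsum q s = q ^+ k + powsum q (rem k s).
Proof. by move=> ks; rewrite /powsum (perm_big _ (perm_to_rem ks)) big_cons. Qed.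

Lemma powsum_cat s t : powsum q (s ++ t) = powsum q s + powsum q t.
Proof. by rewrite /powsum big_cat. Qed.

Lemma powsum_nseq n k : powsum q (nseq n k) = n%:R * q ^+ k.
Proof. by rewrite /powsum big_nseq iter_addr_0 mulr_natl. Qed.

Lemma powsum_ge k s : k \in s -> q ^+ k <= powsum q s.
Proof. by move=> /powsum_rem ->; rewrite lerDl powsum_ge0. Qed.

Lemma natr_denq_gt0 : 0 < (b_ q)%:R :> rat.
Proof. by rewrite ltr0n absz_gt0 denq_neq0. Qed.

Lemma mul_natr_denq : (b_ q)%:R * q = (a_ q)%:R.
Proof.
have -> : (b_ q)%:R = (denq q)%:~R :> rat.
  by rewrite -[in RHS](gtz0_abs (denq_gt0 q)).
have -> : (a_ q)%:R = (numq q)%:~R :> rat.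
  by rewrite -[in RHS](@gtz0_abs (numq q)) // numq_gt0.
by rewrite mulrC -{1}(divq_num_den q) divfK // intr_eq0 denq_neq0.
Qed.

Lemma exp_natr_denq L k : (k <= L)%N ->
  (b_ q)%:R ^+ L * q ^+ k = (a_ q ^ k * b_ q ^ (L - k))%:R.
Proof.
move=> kL; rewrite -{1}(subnK kL) exprD -mulrA -exprMn mul_natr_denq mulrC.
by rewrite natrM !natrX.
Qed.

Lemma levD L x y : lev q L x -> lev q L y -> lev q L (x + y).
Proof. by rewrite /lev mulrDr; apply: rpredD. Qed.

Lemma lev_exp L k : (k <= L)%N -> lev q L (q ^+ k).
Proof. by move=> kL; rewrite /lev exp_natr_denq // natr_nat. Qed.

Lemma lev_powsum L s : all (fun k => k <= L)%N s -> lev q L (powsum q s).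
Proof.
elim: s => [|k s IH] /=; first by rewrite /lev /powsum big_nil mulr0.
by move=> /andP[kL sL]; rewrite /powsum big_cons levD ?lev_exp ?IH.
Qed.

Lemma lev_le L L' x : (L <= L')%N -> lev q L x -> lev q L' x.
Proof.
by move=> LL' ?; rewrite /lev -(subnK LL') exprD -mulrA -natrX rpredM // natr_nat.
Qed.

Lemma inMq_lev x : inMq q x -> exists L, lev q L x.
Proof.
move=> /inMqE[s ->]; exists (\max_(k <- s) k); apply: lev_powsum.
by apply/allP => k ks; apply: (@leq_bigmax_seq _ s xpredT id).
Qed.

Lemma levB L x y : y <= x -> lev q L x -> lev q L y -> lev q L (x - y).
Proof.
rewrite /lev mulrBr => yx /natrP[m hm] /natrP[n hn]; rewrite hm hn.
have nm : (n <= m)%N by rewrite -(ler_nat rat) -hm -hn ler_wpM2l // exprn_ge0.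
by rewrite -natrB // natr_nat.
Qed.

Lemma expoK L x : lev q L x -> (expo q L x)%:R = (b_ q)%:R ^+ L * x.
Proof. by move=> /truncnK. Qed.

Lemma expoD L x y : lev q L x -> lev q L y ->
  expo q L (x + y) = (expo q L x + expo q L y)%N.
Proof.
move=> hx hy; apply/eqP; rewrite -(eqr_nat rat) natrD !expoK ?levD //.
by rewrite mulrDr.
Qed.

Lemma expo_inj L x y : lev q L x -> lev q L y -> expo q L x = expo q L y -> x = y.
Proof.
move=> hx hy /(congr1 (fun n => n%:R : rat)); rewrite !expoK //.
by apply: mulfI; rewrite expf_neq0 // lt0r_neq0 // natr_denq_gt0.
Qed.

Lemma expo_add L n x : lev q L x -> expo q (L + n) x = (expo q L x * b_ q ^ n)%N.
Proof.
move=> hx; apply/eqP; rewrite -(eqr_nat rat) natrM natrX !expoK //.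
  by rewrite exprD mulrAC.
by apply: lev_le hx; rewrite leq_addr.
Qed.

Lemma coprime_ab : coprime (a_ q) (b_ q).
Proof. exact: coprime_num_den. Qed.

(* The largest index L > K occurs a multiple of b times, since [powsum q s] has
   denominator dividing b^K; the carry b q^L = a q^(L-1) then lowers it. *)
Lemma powsum_carry n K s : all (fun k => k <= K + n)%N s ->
  has (fun k => K <= k)%N s -> lev q K (powsum q s) ->
  inMq q (powsum q s - q ^+ K).
Proof.
elim: n s => [|n IH] s /allP sle /hasP[k ks Kk] levs.
  have /eqP kK : k == K by rewrite eqn_leq Kk -[X in (_ <= X)%N]addn0 sle.
  by rewrite (powsum_rem ks) kK addrAC subrr add0r; apply: inMq_powsum.
set L := (K + n).+1; set c := count_mem L s; set r := filter (predC1 L) s.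
have r_le : all (fun k => k <= K + n)%N r.
  apply/allP => j; rewrite mem_filter => /andP[/= jL /sle].
  by rewrite addnS leq_eqVlt (negPf jL).
have sE : powsum q s = c%:R * q ^+ L + powsum q r.
  rewrite /powsum (bigID (pred1 L)) /= -big_filter -[X in _ + X]big_filter.
  congr (_ + _); rewrite -powsum_nseq /powsum; congr bigop.
  by rewrite /c -size_filter; apply/all_pred1P/filter_all.
have bc : (b_ q %| c)%N.
  have h1 : lev q (K + n) (powsum q s) by apply: lev_le levs; rewrite leq_addr.
  have h2 := lev_powsum r_le.
  have : lev q (K + n) (c%:R * q ^+ L).
    have -> : c%:R * q ^+ L = powsum q s - powsum q r by rewrite sE addrK.
    by apply: levB => //; rewrite sE lerDr mulr_ge0 // exprn_ge0 // ltW.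
  rewrite /lev => /natrP[m hm].
  have : (c * a_ q ^ L = m * b_ q)%N.
    apply/eqP; rewrite -(eqr_nat rat) !natrM natrX -hm -mul_natr_denq exprMn.
    by apply/eqP; rewrite [X in _ * (X * _) = _](exprS _ (K + n)); ring.
  move=> caE; have : (b_ q %| c * a_ q ^ L)%N by rewrite caE dvdn_mull.
  by rewrite Gauss_dvdl // coprimeXr // coprime_sym coprime_ab.
have sE' : powsum q s = powsum q (r ++ nseq (c %/ b_ q * a_ q) (K + n)).
  rewrite powsum_cat powsum_nseq sE addrC; congr (_ + _).
  rewrite /L exprS -{1}(divnK bc) !natrM -!mulrA; congr (_ * _).
  by rewrite mulrA mul_natr_denq.
rewrite sE'; apply: IH; last by rewrite -sE'.
  by rewrite all_cat r_le; apply/allP => j /nseqP[->].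
rewrite has_cat; have [kL|kL] := eqVneq k L; last first.
  by apply/orP; left; apply/hasP; exists k => //; rewrite mem_filter ks /= kL.
(* If the given index is [L] itself, the carry supplies a summand of index [K + n]: b divides c > 0
   and a > 0, so at least one copy appears. *)
apply/orP; right; apply/hasP; exists (K + n)%N; last by rewrite leq_addr.
rewrite mem_nseq eqxx andbT muln_gt0 absz_gt0 numq_eq0 gt_eqF // andbT.
have c0 : (0 < c)%N by rewrite -has_count has_pred1 -kL.
by rewrite divn_gt0 ?absz_gt0 ?denq_neq0 // dvdn_leq.
Qed.

(** Adding [q ^+ k] back gives a representation of [x] with an index at least [K], to which the
    carry applies. *)
Lemma inMq_sub K k x : lev q K x -> (K <= k)%N -> inMq q (x - q ^+ k) ->
  inMq q (x - q ^+ K).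
Proof.
move=> levx Kk /inMqE[s hs].
have xE : x = powsum q (k :: s) by rewrite /powsum big_cons -/(powsum q s) -hs addrC subrK.
have := @powsum_carry (\max_(j <- k :: s) j) K (k :: s); rewrite -xE; apply => //.
  apply/allP => j js; apply: leq_trans (leq_addl _ _).
  exact: (@leq_bigmax_seq _ (k :: s) xpredT id).
by rewrite /= Kk.
Qed.

Hypothesis q_lt1 : q < 1.

Lemma powsum_lt i s : powsum q s < q ^+ i -> all (fun k => i < k)%N s.
Proof.
move=> h; apply/allP => k ks; rewrite ltnNge; apply: contraL h => ki.
rewrite -leNgt; apply: le_trans (powsum_ge ks).
by rewrite ler_wiXn2l // ltW.
Qed.

Lemma powsum_shift i s : all (fun k => i <= k)%N s ->
  powsum q s = q ^+ i * powsum q [seq k - i | k <- s]%N.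
Proof.
move=> /allP sle; rewrite /powsum big_map mulr_sumr; apply: eq_big_seq => k ks.
by rewrite -exprD subnKC // sle.
Qed.

(** Every summand of [x] is below q^i, hence is a q^k with k > i, and x = q^(i+1) x' with x' in M_q.
    Multiplying by powers of b turns q^(i+1) into a^(i+1), and these powers cancel because a and b
    are coprime. *)
Lemma dvdn_expo i L x : inMq q x -> x < q ^+ i -> lev q L x ->
  (a_ q ^ i.+1 %| expo q L x)%N.
Proof.
move=> /inMqE[s xE] xi levx; rewrite xE in xi.
have sh := powsum_shift (powsum_lt xi); rewrite -xE in sh.
have [K levK] := inMq_lev (inMq_powsum [seq k - i.+1 | k <- s]%N).
have : (expo q L x * b_ q ^ (i.+1 + K) =
  a_ q ^ i.+1 * (b_ q ^ L * expo q K (powsum q [seq k - i.+1 | k <- s])))%N.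
  apply/eqP; rewrite -(eqr_nat rat) !natrM !natrX !expoK // -mul_natr_denq exprMn.
  by apply/eqP; rewrite {1}sh exprD; ring.
move=> E; have : (a_ q ^ i.+1 %| expo q L x * b_ q ^ (i.+1 + K))%N.
  by rewrite E dvdn_mulr.
by rewrite Gauss_dvdl // coprimeXl // coprimeXr // coprime_ab.
Qed.

(** A numerator 1 would give q = 1/b, with b >= 2 because q < 1. *)
Lemma numq_gt1 : (forall n : nat, (2 <= n)%N -> q != n%:R^-1) -> (1 < a_ q)%N.
Proof.
move=> q_not_inv.
have a0 : (0 < a_ q)%N by rewrite absz_gt0 numq_eq0 gt_eqF.
rewrite ltn_neqAle a0 andbT; apply/negP => /eqP a1.
have := mul_natr_denq; rewrite -a1 => h.
have b0 := natr_denq_gt0.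
have b2 : (2 <= b_ q)%N.
  by rewrite -(ltr_nat rat) -h -[X in _ < X]mulr1 ltr_pM2l.
have /negP[] := q_not_inv _ b2.
by rewrite -(inj_eq (mulfI (lt0r_neq0 b0))) h mulfV // gt_eqF.
Qed.

(** This makes q^K an atom of M_q. If 0 < n < q^K, then n and q^K - n only have summands of index
    above K; dividing their sum by q^K gives 1 = q x' with x' in M_q. Clearing denominators, a
    divides a power of b, so a = 1. *)
Lemma inMq_atom K n : (1 < a_ q)%N -> inMq q n -> n != 0 ->
  inMq q (q ^+ K - n) -> q ^+ K <= n.
Proof.
move=> a1 /inMqE[s ns] n0 /inMqE[t nt]; rewrite leNgt; apply/negP => nK.
have n_gt0 : 0 < n by rewrite lt_def n0 ns powsum_ge0.
have stE : powsum q (s ++ t) = q ^+ K by rewrite powsum_cat -ns -nt addrC subrK.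
have : all (fun k => K < k)%N (s ++ t).
  by rewrite all_cat !powsum_lt // -?ns // -nt gtrBl.
move=> /powsum_shift; rewrite stE; set r := map _ _.
have [L levr] := inMq_lev (inMq_powsum r).
rewrite exprSr -mulrA -[LHS]mulr1 => /(mulfI (lt0r_neq0 (exprn_gt0 K q_gt0))) h.
have : (b_ q ^ L.+1 = a_ q * expo q L (powsum q r))%N.
  apply/eqP; rewrite -(eqr_nat rat) natrM natrX expoK // -mul_natr_denq.
  have -> : (b_ q)%:R ^+ L.+1 = (b_ q)%:R ^+ L.+1 * (q * powsum q r) :> rat.
    by rewrite -h mulr1.
  by apply/eqP; rewrite exprS; ring.
move=> E; have : (a_ q %| 1 * b_ q ^ L.+1)%N by rewrite mul1n E dvdn_mulr.
rewrite Gauss_dvdl ?coprimeXr ?coprime_ab // dvdn1 => /eqP a_eq1.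
by rewrite a_eq1 in a1.
Qed.
End Monoid.

(** * Elements of the algebra as polynomials in y = x^(1/b^L), and their roots *)

Definition levmalg (q : rat) (L : nat) (f : monoid_algebra rat q) : Prop :=
  forall k, k \in msupp f -> lev q L (val k).

(** This rewrites [f] in the variable y. It is faithful and multiplicative only under [levmalg],
    since [expo] truncates outside level [L]. *)
Definition topoly (q : rat) (L : nat) (f : monoid_algebra rat q) : {poly rat} :=
  mmap polyC (fun k : Mq q => 'X^(expo q L (val k))) f.

Section Algebra.
Context (q : rat) (q_gt0 : 0 < q).
Implicit Types f g h : monoid_algebra rat q.

Lemma inMq_val (k : Mq q) : inMq q (val k).
Proof. exact/memMqP/(valP k). Qed.

Lemma val_mmul (k l : Mq q) : val (mmul k l) = val k + val l.
Proof. by []. Qed.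

Lemma levmalg_le L L' f : (L <= L')%N -> levmalg L f -> levmalg L' f.
Proof. by move=> LL' hf k /hf; apply: lev_le. Qed.

Lemma levmalg_ex f : exists L, levmalg L f.
Proof.
have : forall s : seq (Mq q), exists L, forall k, k \in s -> lev q L (val k).
  elim=> [|k s [L hL]]; first by exists 0%N.
  have [L' hL'] := inMq_lev q_gt0 (inMq_val k).
  exists (maxn L L') => j; rewrite inE => /predU1P[->|/hL].
    exact: lev_le (leq_maxr _ _) hL'.
  exact: lev_le (leq_maxl _ _).
exact.
Qed.

Lemma levmalgM L f g : levmalg L f -> levmalg L g -> levmalg L (f * g).
Proof.
move=> hf hg k /msuppM_le[k1 [k2 [/hf h1 /hg h2 ->]]].
by rewrite val_mmul levD.
Qed.

Lemma topolyE L f :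
  topoly L f = \sum_(k <- msupp f) f@_k *: 'X^(expo q L (val k)).
Proof. by rewrite /topoly mmapE; apply: eq_bigr => k _; rewrite mul_polyC. Qed.

Lemma topolyM L f g : levmalg L f -> levmalg L g ->
  topoly L (f * g) = topoly L f * topoly L g.
Proof.
move=> hf hg; rewrite malgME /topoly raddf_sum /= [X in _ = X * _]mmapE big_distrl /=.
rewrite big_seq [RHS]big_seq; apply: eq_bigr => k1 /hf h1.
rewrite raddf_sum /= [X in _ = _ * X]mmapE big_distrr /=.
rewrite big_seq [RHS]big_seq; apply: eq_bigr => k2 /hg h2.
by rewrite mmapU val_mmul expoD // exprD [RHS]mulrACA; congr (_ * _); exact: polyCM.
Qed.

(** At level [L] the map [expo] is injective, so no two terms of [f] fall on the same power of y. *)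
Lemma coef_topoly L f k : levmalg L f -> lev q L (val k) ->
  (topoly L f)`_(expo q L (val k)) = f@_k.
Proof.
move=> hf hk; rewrite topolyE coef_sum.
under eq_bigr do rewrite coefZ coefXn.
have [kf|kf] := boolP (k \in msupp f).
  rewrite (big_rem k) //= eqxx mulr1 big_seq big1 ?addr0 // => j.
  rewrite mem_rem_uniq ?fset_uniq // inE => /andP[jk jf].
  case: eqP => [/(expo_inj hk (hf _ jf))/val_inj kj|]; last by rewrite mulr0.
  by rewrite kj eqxx in jk.
rewrite mcoeff_outdom // big_seq big1 // => j jf.
case: eqP => [/(expo_inj hk (hf _ jf))/val_inj kj|]; last by rewrite mulr0.
by rewrite kj jf in kf.
Qed.

Lemma coef_topoly_neq0 L f i : (topoly L f)`_i != 0 ->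
  exists2 k, k \in msupp f & expo q L (val k) = i.
Proof.
move=> fi; have : has (fun k => expo q L (val k) == i) (msupp f).
  apply: contraR fi => /hasPn h; rewrite topolyE coef_sum big_seq big1 // => k /h.
  by rewrite coefZ coefXn eq_sym => /negPf ->; rewrite mulr0.
by case/hasP => k kf /eqP; exists k.
Qed.

Lemma topoly_neq0 L f : levmalg L f -> f != 0 -> topoly L f != 0.
Proof.
move=> hf; rewrite -msupp_eq0 => /fset0Pn[k kf]; apply/eqP => f0.
by have := coef_topoly hf (hf k kf); rewrite f0 coef0 => /esym/eqP; rewrite mcoeff_eq0 kf.
Qed.

Lemma expo_lt_size L f k : levmalg L f -> k \in msupp f ->
  (expo q L (val k) < size (topoly L f))%N.
Proof.
move=> hf kf; rewrite ltnNge; apply/negP => /leq_sizeP/(_ _ (leqnn _)).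
by move/eqP; rewrite coef_topoly ?hf // mcoeff_eq0 kf.
Qed.

Lemma horner_topoly L f (z : algC) :
  (map_poly ratr (topoly L f)).[z] =
  \sum_(k <- msupp f) ratr f@_k * z ^+ expo q L (val k).
Proof.
rewrite topolyE rmorph_sum /= horner_sum; apply: eq_bigr => k _.
by rewrite map_polyZ map_polyXn !hornerE.
Qed.

(** The bound for divisors with nonzero constant term. The index [i] is fixed before [h], so the
    bound is uniform over all such divisors. *)
Lemma divisor_exponent_ge g K : q < 1 -> (1 < a_ q)%N -> levmalg K g -> g != 0 ->
  exists i, forall h h', g = h * h' -> mone \in msupp h ->
    (exists2 k, k \in msupp h & k != mone) ->
    exists2 e, e \in msupp h & q ^+ i <= val e.
Proof.
move=> q_lt1 a1 gK g0; set i := size (topoly K g); exists i => h h' gE h1 [k kh k1].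
have [/hasP[e]|/hasPn hlt] := boolP (has (fun e => q ^+ i <= val e) (msupp h)).
  by exists e.
exfalso.
have [L1 hL1] := levmalg_ex h; have [L2 hL2] := levmalg_ex h'.
pose L := maxn K (maxn L1 L2).
have hL : levmalg L h by apply: levmalg_le hL1; rewrite /L !leq_max leqnn orbT.
have hL' : levmalg L h' by apply: levmalg_le hL2; rewrite /L !leq_max leqnn !orbT.
have KL : (K <= L)%N by rewrite leq_max leqnn.
set A := (a_ q ^ i.+1)%N.
have Advd e : e \in msupp h -> (A %| expo q L (val e))%N.
  move=> eh; apply: (dvdn_expo q_gt0 q_lt1 (inMq_val e) _ (hL _ eh)).
  by rewrite ltNge hlt.
have expo1 : expo q L (val (mone : Mq q)) = 0%N by rewrite /expo mulr0 Num.Theory.truncn0.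
have A_gt0 : (0 < A)%N by rewrite expn_gt0 ltnW.
have [w prw] := C_prim_root_exists A_gt0.
have [z hz] : exists z, root (map_poly ratr (topoly L h) : {poly algC}) z.
  apply/closed_rootP; rewrite size_map_poly gtn_eqF //.
  apply: leq_trans (expo_lt_size hL kh); rewrite ltnS lt0n -expo1.
  by apply: contraNneq k1 => /(expo_inj (hL _ kh) (hL _ h1))/val_inj ->.
(* The constant coefficient of [h] is nonzero. A root 0 would make all the [y j] below coincide. *)
have z0 : z != 0.
  apply: contraTneq hz => ->; rewrite rootE horner_coef0 coef_map /= -expo1.
  by rewrite coef_topoly ?hL // fmorph_eq0 mcoeff_neq0.
(* The level [L] depends on [h]. Since g at level L, evaluated at y, is g at level K, evaluated at
   y^B, taking B-th powers leads to roots of a polynomial independent of [h]. *)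
pose B := (b_ q ^ (L - K))%N; pose y j := (w ^+ j * z) ^+ B.
have rooty j : root (map_poly ratr (topoly K g)) (y j).
  rewrite rootE; have -> : (map_poly ratr (topoly K g)).[y j] =
      (map_poly ratr (topoly L g)).[w ^+ j * z].
    rewrite !horner_topoly big_seq [RHS]big_seq; apply: eq_bigr => k' kg.
    have -> : expo q L (val k') = (B * expo q K (val k'))%N.
      by rewrite mulnC -expo_add ?gK // subnKC.
    by rewrite exprM.
  rewrite gE topolyM // rmorphM hornerM mulf_eq0; apply/orP; left.
  (* All exponents of [h] at level [L] are multiples of [A], and w^A = 1. *)
  suff -> : (map_poly ratr (topoly L h)).[w ^+ j * z] =
      (map_poly ratr (topoly L h)).[z].
    exact: hz.
  rewrite !horner_topoly big_seq [RHS]big_seq; apply: eq_bigr => e /Advd/dvdnP[c ->].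
  by rewrite exprMn -exprM mulnA [X in w ^+ X]mulnC exprM (prim_expr_order prw)
    expr1n mul1r.
(* [A] is a power of a and [B] a power of b, so they are coprime and w^B is again a primitive A-th
   root of unity. *)
have y_inj : {in iota 0 A &, injective y}.
  move=> j j'; rewrite !mem_iota /= add0n => jA j'A; rewrite /y !exprMn.
  move=> /(mulIf (expf_neq0 B z0)); rewrite ![w ^+ _ ^+ B]exprAC => /eqP.
  rewrite (@eq_prim_root_expr _ A); first by rewrite !modn_small // => /eqP.
  by rewrite prim_root_exp_coprime // coprimeXl // coprimeXr // coprime_sym coprime_ab.
have := @max_poly_roots _ (map_poly ratr (topoly K g)) [seq y j | j <- iota 0 A].
rewrite map_poly_eq0 topoly_neq0 // size_map size_iota size_map_poly => /(_ isT).
have -> : all (root (map_poly ratr (topoly K g))) [seq y j | j <- iota 0 A].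
  by apply/allP => _ /mapP[j _ ->].
rewrite map_inj_in_uniq ?iota_uniq // => /(_ isT isT).
(* The A distinct roots force A < i, whereas i < a^i <= A. *)
by rewrite ltnNge (leq_trans (ltnW (ltn_expl i a1))) // leq_exp2l.
Qed.

End Algebra.

(** * Factorization into atoms in a commutative ring *)

Section Factorization.
Context (A : comNzRingType).
Implicit Types x y u : A.

Lemma is_unitM x y : is_unit x -> is_unit y -> is_unit (x * y).
Proof. by move=> [x' hx] [y' hy]; exists (x' * y'); rewrite mulrACA hx hy mulr1. Qed.

Lemma is_unitMl x y : is_unit (x * y) -> is_unit x.
Proof. by move=> [z h]; exists (y * z); rewrite mulrA. Qed.

Lemma atom_unitM u x : is_unit u -> atom x -> atom (u * x).
Proof.
move=> [v uv] [x0 xu xirr]; have vx : v * (u * x) = x by rewrite mulrA [v * u]mulrC uv mul1r.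
split; first by apply: contraNneq x0 => h; rewrite -vx h mulr0.
  by rewrite mulrC => /is_unitMl.
move=> y z h; have /xirr[/[1!mulrC]/is_unitMl|] : x = (v * y) * z by rewrite -mulrA -h vx.
  by left.
by right.
Qed.

Lemma nonatom_split x : x != 0 -> ~ is_unit x -> ~ atom x ->
  exists y z, [/\ x = y * z, ~ is_unit y & ~ is_unit z].
Proof.
move=> x0 xu xa; apply: NNPP => h; apply: xa; split=> // y z xyz.
have [yu|yu] := classic (is_unit y); first by left.
have [zu|zu] := classic (is_unit z); first by right.
by case: h; exists y, z.
Qed.

(** The unit factor admits units as empty products, so that products and inductions need no separate
    case for them. *)
Definition atomic_product x : Prop :=
  exists u s, [/\ is_unit u, forall a, a \in s -> atom a & x = u * \prod_(a <- s) a].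

Lemma atomic_productM x y :
  atomic_product x -> atomic_product y -> atomic_product (x * y).
Proof.
move=> [u [s [uu sa ->]]] [v [t [vu ta ->]]]; exists (u * v), (s ++ t); split.
- exact: is_unitM.
- by move=> a; rewrite mem_cat => /orP[/sa|/ta].
- by rewrite big_cat mulrACA.
Qed.

(** The unit is absorbed into the first atom; there is one, as otherwise [x] would be a unit. *)
Lemma atomic_product_nonunit x : atomic_product x -> ~ is_unit x ->
  exists s, (forall a, a \in s -> atom a) /\ x = \prod_(a <- s) a.
Proof.
move=> [u [[|a s] [uu sa ->]]] xu; first by case: xu; rewrite big_nil mulr1.
exists (u * a :: s); split; last by rewrite !big_cons mulrA.
move=> c; rewrite inE => /predU1P[->|cs].
  by apply: atom_unitM => //; apply: sa; rewrite mem_head.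
by apply: sa; rewrite inE cs orbT.
Qed.

(** Splitting a factor that is not an atom lengthens the factorization by one, which the bound
    allows only finitely often. *)
Lemma bounded_atomic_product x N : x != 0 ->
  (forall s, (forall a, a \in s -> ~ is_unit a) -> x = \prod_(a <- s) a ->
    (size s <= N)%N) ->
  atomic_product x.
Proof.
move=> x0 bnd; have [xu|xu] := classic (is_unit x).
  by exists x, [::]; rewrite big_nil mulr1.
(* Here [k] limits the number of splittings still possible; at k = 0 the list is already too
   long. *)
suff H k : forall s, (forall a, a \in s -> ~ is_unit a) -> x = \prod_(a <- s) a ->
    (N < size s + k)%N -> atomic_product x.
  apply: (H N [:: x]); rewrite ?big_seq1 // => a.
  by rewrite inE => /eqP ->.
elim: k => [|k IH] s snu xE Nk.
  by move: Nk; rewrite addn0 ltnNge bnd.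
have [sa|sna] := classic (forall a, a \in s -> atom a).
  by exists 1, s; rewrite mul1r; split=> //; exists 1; rewrite mulr1.
have [a sna_a] := not_all_ex_not _ _ sna.
have [as_ ana] := imply_to_and _ _ sna_a.
have xE' : x = a * \prod_(c <- rem a s) c.
  by rewrite xE (perm_big _ (perm_to_rem as_)) big_cons.
have a0 : a != 0 by apply: contraNneq x0 => a0; rewrite xE' a0 mul0r.
have [y [z [ayz yu zu]]] := nonatom_split a0 (snu a as_) ana.
apply: (IH [:: y, z & rem a s]).
- by move=> c; rewrite !inE => /or3P[/eqP->|/eqP->|/mem_rem/snu].
- by rewrite !big_cons mulrA -ayz.
- have s_gt0 : (0 < size s)%N by case: (s) as_.
  by rewrite /= size_rem // prednK // addSnnS.
Qed.

End Factorization.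

(** * Atomicity of the monoid algebra *)

Section Atomicity.
Context (q : rat) (q_gt0 : 0 < q).
Implicit Types f g h : monoid_algebra rat q.

Lemma const_unit h : h != 0 -> (forall k, k \in msupp h -> k = mone) -> is_unit h.
Proof.
move=> h0 hk; have hE : h = malgC h@_mone.
  apply/malgP => k; rewrite mcoeffC; case: eqP => [->|]; first by rewrite mulr1n.
  move=> k1; rewrite mulr0n mcoeff_outdom //; apply/negP => /hk; exact: k1.
have c0 : h@_mone != 0 by apply: contraNneq h0 => c0; rewrite hE c0 malgC0E.
move: (h@_mone) hE c0 => c -> c0; exists (malgC c^-1).
by rewrite -mpolyCM mulfV.
Qed.

Lemma levmalg_common (s : seq (monoid_algebra rat q)) :
  exists L, forall f, f \in s -> levmalg L f.
Proof.
elim: s => [|f s [L hL]]; first by exists 0%N.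
have [L' hL'] := levmalg_ex q_gt0 f.
exists (maxn L L') => g; rewrite inE => /predU1P[->|/hL].
  exact: levmalg_le (leq_maxr _ _) hL'.
exact: levmalg_le (leq_maxl _ _).
Qed.

Lemma val_mone : val (mone : Mq q) = 0.
Proof. by []. Qed.

Lemma levmalg1 L : levmalg L (1 : monoid_algebra rat q).
Proof.
by move=> k; rewrite -mpolyC1E => /(fsubsetP (msuppC_le _)); rewrite inE => /eqP ->;
  rewrite /lev val_mone mulr0.
Qed.

(** Degrees in y add up, and each factor contributes at least b^L d. The first two conclusions carry
    the induction. *)
Lemma size_topoly_prod L d (s : seq (monoid_algebra rat q)) :
  (forall h, h \in s -> [/\ levmalg L h, h != 0 &
     exists2 e, e \in msupp h & d <= val e]) ->
  [/\ levmalg L (\prod_(h <- s) h), topoly L (\prod_(h <- s) h) != 0 &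
   (size s)%:R * ((b_ q)%:R ^+ L * d)
     <= ((size (topoly L (\prod_(h <- s) h))).-1)%:R].
Proof.
elim: s => [|h s IH] hs.
  rewrite big_nil; split; first exact: levmalg1.
    by rewrite topoly_neq0 ?oner_neq0 //; apply: levmalg1.
  by rewrite mul0r.
have [hL h0 [e eh de]] := hs h (mem_head _ _).
have [|sL s0 IHs] := IH; first by move=> g gs; apply: hs; rewrite inE gs orbT.
have th0 := topoly_neq0 hL h0.
rewrite big_cons; split; first exact: levmalgM.
  by rewrite topolyM // mulf_neq0.
rewrite topolyM // size_mul //.
have -> : ((size (topoly L h) + size (topoly L (\prod_(g <- s) g))).-1.-1 =
  (size (topoly L h)).-1 + (size (topoly L (\prod_(g <- s) g))).-1)%N.
  move: th0 s0; rewrite -!size_poly_gt0.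
  by case: (size _) => // m; case: (size _) => // n _ _; rewrite addSn addnS.
rewrite natrD /= -add1n natrD mulrDl mul1r lerD //.
apply: (@le_trans _ _ (expo q L (val e))%:R).
  by rewrite expoK ?hL // ler_wpM2l // exprn_ge0.
by rewrite ler_nat -ltnS prednK ?size_poly_gt0 // expo_lt_size.
Qed.

Lemma lower_bound_atomic_product g d : 0 < d -> g != 0 ->
  (forall h h', g = h * h' -> ~ is_unit h -> exists2 e, e \in msupp h & d <= val e) ->
  atomic_product g.
Proof.
move=> d0 g0 hd; set D := \sum_(k <- msupp g) val k.
(* The exponents are nonnegative, so their sum [D] bounds the degree of [g] in x; hence there are at
   most D / d nonunit factors. *)
apply: (@bounded_atomic_product _ g (Num.bound (D / d)) g0) => s snu gE.
have [L hL] := levmalg_common s.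
have [h hs|sL s0] := @size_topoly_prod L d s.
  have gE' : g = h * \prod_(c <- rem h s) c.
    by rewrite gE (perm_big _ (perm_to_rem hs)) big_cons.
  split; first exact: hL.
    by apply: contraNneq g0 => h0; rewrite gE' h0 mul0r.
  by apply: hd gE' (snu h hs).
rewrite -gE in sL s0 *.
have : (topoly L g)`_(size (topoly L g)).-1 != 0 by rewrite -/(lead_coef _) lead_coef_eq0.
case/coef_topoly_neq0 => k kg <-; rewrite expoK ?sL // mulrCA ler_pM2l; last first.
  by rewrite exprn_gt0 // natr_denq_gt0.
move=> h; have : (size s)%:R <= D / d.
  rewrite ler_pdivlMr //; apply: le_trans h _.
  rewrite /D (big_rem k) //= lerDl; apply: sumr_ge0 => j _; exact: Mq_ge0.
move=> /le_lt_trans => H; rewrite ltnW // -(ltr_nat rat) H // archi_boundP //.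
by apply: divr_ge0 (ltW d0); apply: sumr_ge0 => j _; apply: Mq_ge0.
Qed.

Hypothesis q_lt1 : q < 1.
Hypothesis a_gt1 : (1 < a_ q)%N.

(** For g = h h', write m = n + n' with n, n' in the supports of h, h'. If n is nonzero, it is at
    least [d]; if n = 0, then h has a constant term and the root argument bounds its degree. *)
Lemma good_atomic_product g m d : 0 < d -> m \in msupp g ->
  (forall n n' : Mq q, m = mmul n n' -> n != mone -> d <= val n) ->
  atomic_product g.
Proof.
move=> d0 mg md; have g0 : g != 0.
  by rewrite -msupp_eq0; apply/fset0Pn; exists m.
have [K gK] := levmalg_ex q_gt0 g.
have [i hi] := divisor_exponent_ge q_gt0 q_lt1 a_gt1 gK g0.
have qi0 : 0 < q ^+ i by rewrite exprn_gt0.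
apply: (@lower_bound_atomic_product g (Num.min d (q ^+ i))) => //.
  by rewrite lt_min d0.
move=> h h' gE hu; move: (mg); rewrite gE => /msuppM_le[n [n' [nh n'h mE]]].
have [n1|n1] := eqVneq n mone; last first.
  by exists n => //; rewrite ge_min (md n n').
have [e eh ei] : exists2 e, e \in msupp h & q ^+ i <= val e.
  apply: (hi h h' gE); first by rewrite -n1.
  apply: NNPP => hc; apply: hu; apply: const_unit.
    by apply: contraNneq g0 => h0; rewrite gE h0 mul0r.
  move=> k kh; apply/eqP; apply: contraPT isT => k1 _; apply: hc; by exists k.
by exists e => //; rewrite ge_min ei orbT.
Qed.

Lemma memMq_exp K : memMq q (q ^+ K).
Proof. by apply/memMqP/inMqE => //; exists [:: K]; rewrite /powsum big_seq1. Qed.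

Definition Mq_exp K : Mq q := exist _ (q ^+ K) (memMq_exp K).

(** As q^K is an atom of M_q, its only nonzero divisor is itself, so d = q^K is admissible. *)
Lemma monomial_atomic_product K : atomic_product (<< Mq_exp K >> : monoid_algebra rat q).
Proof.
apply: (@good_atomic_product _ (Mq_exp K) (q ^+ K)).
- by rewrite exprn_gt0.
- by rewrite msuppU1 inE.
move=> n n' /(congr1 val) /= nE n1.
apply: (inMq_atom q_gt0 q_lt1 a_gt1); first exact: inMq_val.
  by apply: contraNneq n1 => n0; apply/eqP/val_inj.
have -> : q ^+ K - val n = val n' by rewrite nE addrC addKr.
exact: inMq_val.
Qed.

(** Induction on [J]: each factor x^(q^K) taken out lowers the exponent [m] by q^K, while the level
    [K] stays fixed. *)
Lemma level_atomic_product K J f : levmalg K f ->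
  (exists2 m, m \in msupp f & val m < J%:R * q ^+ K) -> atomic_product f.
Proof.
elim: J f => [|J IH] f fK [m mf mJ].
  by move: mJ; rewrite mul0r ltNge Mq_ge0.
have [fq|] := classic (forall k, k \in msupp f -> inMq q (val k - q ^+ K)); last first.
  move=> /not_all_ex_not[k nk]; have [kf kq] := imply_to_and _ _ nk.
  (* A nonzero divisor n < q^K of [k] would contain some q^j with j > K; exchanging it for q^K would
     put k - q^K in M_q. *)
  apply: (@good_atomic_product _ k (q ^+ K)) => //; first by rewrite exprn_gt0.
  move=> n n' kE n1; rewrite leNgt; apply/negP => nK; apply: kq.
  have /(inMqE q_gt0)[s ns] := inMq_val n.
  case: s ns => [|j s] ns.
    by case/eqP: n1; apply: val_inj; rewrite ns /powsum big_nil.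
  have /andP[Kj _] : all (fun i => K < i)%N (j :: s).
    by apply: (powsum_lt q_gt0 q_lt1); rewrite -ns.
  apply: (inMq_sub q_gt0 (fK k kf) (ltnW Kj)).
  have -> : val k - q ^+ j = powsum q s + val n'.
    by rewrite kE val_mmul ns /powsum big_cons; ring.
  by apply: inMqD; [apply: inMq_powsum | apply: inMq_val].
(* The default value [mone] is never taken on the support of [f], by [fq]. *)
pose sh (k : Mq q) : Mq q := insubd (mone : Mq q) (val k - q ^+ K).
have shE k : k \in msupp f -> val (sh k) = val k - q ^+ K.
  by move=> kf; apply: insubdK; apply/memMqP/fq.
pose g : monoid_algebra rat q := \sum_(k <- msupp f) << f@_k *g sh k >>.
have fE : f = << Mq_exp K >> * g.
  rewrite {1}(monalgE f) /g mulr_sumr; apply: eq_big_seq => k kf.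
  rewrite malgM_def fgmulUU mul1r; congr (mkmalgU _ _); apply: val_inj.
  by rewrite val_mmul shE //= addrC subrK.
(* The support of [g] lies in the image of [sh], and subtracting q^K, itself of level [K], preserves
   the level. *)
have gK : levmalg K g.
  move=> k kg; have /hasP[j jf /eqP <-] : has (fun j => sh j == k) (msupp f).
    apply: contraLR kg => /hasPn h; rewrite -mcoeff_eq0 raddf_sum /=.
    by rewrite big_seq big1 // => j /h /negPf jk; rewrite mcoeffU jk.
  by rewrite shE // levB ?fK ?lev_exp // -subr_ge0 -shE // Mq_ge0.
rewrite fE; apply: atomic_productM; first exact: monomial_atomic_product.
apply: IH => //; move: mf; rewrite {1}fE => /msuppM_le[e [n [+ ng mE]]].
rewrite msuppU1 inE => /eqP eE; exists n => //.
by move: mJ; rewrite mE eE val_mmul /= -natr1 mulrDl mul1r addrC ltrD2r.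
Qed.

End Atomicity.

Theorem theorem5p2 (q : rat) :
  0 < q -> q < 1 ->
  (forall n : nat, (2 <= n)%N -> q != n%:R^-1) ->
  odd `|denq q|%N ->
  atomic (monoid_algebra rat q).
Proof.
move=> q_gt0 q_lt1 q_not_inv _ f f0 fu.
have [K fK] := levmalg_ex q_gt0 f.
have [m mf] : exists m, m \in msupp f by apply/fset0Pn; rewrite msupp_eq0.
have qK0 : 0 < q ^+ K by rewrite exprn_gt0.
(* Any exponent [m] of [f] can start the induction, with J a natural number above m / q^K. *)
apply: atomic_product_nonunit fu; apply: (@level_atomic_product q q_gt0 q_lt1
  (numq_gt1 q_gt0 q_lt1 q_not_inv) K (Num.bound (val m / q ^+ K)) f fK).
exists m => //.
by rewrite -ltr_pdivrMr // archi_boundP // divr_ge0 ?Mq_ge0 // ltW.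
Qed.
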